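(* Let $\gamma$ be a smooth unit speed curve in $E^3$ with Bishop frame $\{T,N_1,N_2\}$ and Bishop curvatures $k_1,k_2$. Let $\chi(s,v)=\frac{T(s)+N_1(s)}{\sqrt2}+v\,N_2(s)$ be the $TN_1$ Smarandache ruled surface. At every point $(s,v)$ with $k_1^2+v^2k_2^2+\sqrt2\,v\,k_1k_2\neq 0$ (that is, where $\chi_s\times\chi_v\ne 0$), the Gaussian curvature $K$ and the mean curvature $H$ of $\chi$ are $$K=-\frac12\left(\frac{k_1k_2}{k_1^2+v^2k_2^2+\sqrt2\,v\,k_1k_2}\right)^2,$$ $$H=\frac{k_1k_2^2(1-2v^2)+v k_2\left(\sqrt2\,k_1'-2\sqrt2\,k_1^2\right)-\sqrt2\,v\,k_1k_2'-2k_1^3}{4\left(k_1^2+v^2k_2^2+\sqrt2\,v\,k_1k_2\right)^{3/2}}.$$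
   Context: $E^3$ is Euclidean 3-space with inner product $\langle\cdot,\cdot\rangle$ and cross product $\times$. A Bishop frame of a smooth unit speed curve $\gamma=\gamma(s)$ is a smooth positively oriented orthonormal frame $\{T,N_1,N_2\}$ along $\gamma$ with $T=\gamma'$ and $T'=k_1N_1+k_2N_2$, $N_1'=-k_1T$, $N_2'=-k_2T$, where $k_1,k_2$ are smooth functions of $s$ (the Bishop curvatures) and $'=d/ds$. For a surface $\chi(s,v)$, put $n=\frac{\chi_s\times\chi_v}{\|\chi_s\times\chi_v\|}$, and $E=\langle\chi_s,\chi_s\rangle$, $F=\langle\chi_s,\chi_v\rangle$, $G=\langle\chi_v,\chi_v\rangle$, $L=\langle\chi_{ss},n\rangle$, $M=\langle\chi_{sv},n\rangle$, $N=\langle\chi_{vv},n\rangle$. Then $K=\frac{LN-M^2}{EG-F^2}$ and $H=\frac{EN-2MF+LG}{2(EG-F^2)}$. *)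

(* Defs.v *)
From HB Require Import structures.
From mathcomp Require Import all_boot all_order all_algebra.
From mathcomp Require Import all_classical all_reals all_analysis.

Set Implicit Arguments.
Unset Strict Implicit.
Unset Printing Implicit Defensive.

Import Order.TTheory GRing.Theory Num.Theory.
Import numFieldNormedType.Exports.

Local Open Scope ring_scope.
Local Open Scope classical_set_scope.

Section EuclideanSpace.
Variable R : realType.
Implicit Types u v w : 'rV[R]_3.

Definition dot u v : R := \sum_(i < 3) u 0 i * v 0 i.

(* The library norm `|u| on 'rV[R]_3 is the sup norm, hence this definition. *)
Definition enorm u : R := Num.sqrt (dot u u).

(* Index arithmetic is in 'I_3, i.e. modulo 3. *)
Definition cross u v : 'rV[R]_3 :=
  \row_(i < 3) (u 0 (i + 1) * v 0 (i + 2) - u 0 (i + 2) * v 0 (i + 1)).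

Definition orthonormal3 u v w : Prop :=
  [/\ dot u u = 1, dot v v = 1 & dot w w = 1] /\
  [/\ dot u v = 0, dot u w = 0 & dot v w = 0].

Definition positively_oriented u v w : Prop :=
  0 < \det (col_mx u (col_mx v w) : 'M[R]_3).

End EuclideanSpace.

Section Curves.
Variable R : realType.

(* For open I, [derive1n n f] at a point of I only depends on f near that
   point, so this is C^oo smoothness of the restriction of f to I. *)
Definition smooth_on (V : normedModType R) (I : set R) (f : R -> V) : Prop :=
  forall (n : nat) (s : R), I s -> derivable (derive1n n f) s 1.

Definition unit_speed_curve (I : set R) (gamma : R -> 'rV[R]_3) : Prop :=
  smooth_on I gamma /\ (forall s, I s -> enorm (derive1 gamma s) = 1).

Record bishop_frame (I : set R) (gamma T N1 N2 : R -> 'rV[R]_3)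
    (k1 k2 : R -> R) : Prop := BishopFrame {
  bishop_smooth : [/\ smooth_on I T, smooth_on I N1 & smooth_on I N2];
  bishop_curv_smooth : smooth_on I k1 /\ smooth_on I k2;
  bishop_orthonormal : forall s, I s -> orthonormal3 (T s) (N1 s) (N2 s);
  bishop_oriented : forall s, I s -> positively_oriented (T s) (N1 s) (N2 s);
  bishop_tangent : forall s, I s -> T s = derive1 gamma s;
  bishop_derivT : forall s, I s ->
    derive1 T s = k1 s *: N1 s + k2 s *: N2 s;
  bishop_derivN1 : forall s, I s -> derive1 N1 s = - k1 s *: T s;
  bishop_derivN2 : forall s, I s -> derive1 N2 s = - k2 s *: T s
}.

End Curves.

Section Surfaces.
Variable R : realType.
Implicit Types (chi : R -> R -> 'rV[R]_3) (s v : R).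

Definition pd_s chi : R -> R -> 'rV[R]_3 :=
  fun s v => derive1 (fun x => chi x v) s.

Definition pd_v chi : R -> R -> 'rV[R]_3 :=
  fun s v => derive1 (fun x => chi s x) v.

Definition surf_normal chi s v : 'rV[R]_3 :=
  let w := cross (pd_s chi s v) (pd_v chi s v) in (enorm w)^-1 *: w.

Definition ffE chi s v : R := dot (pd_s chi s v) (pd_s chi s v).
Definition ffF chi s v : R := dot (pd_s chi s v) (pd_v chi s v).
Definition ffG chi s v : R := dot (pd_v chi s v) (pd_v chi s v).

Definition sfL chi s v : R := dot (pd_s (pd_s chi) s v) (surf_normal chi s v).
Definition sfM chi s v : R := dot (pd_v (pd_s chi) s v) (surf_normal chi s v).
Definition sfN chi s v : R := dot (pd_v (pd_v chi) s v) (surf_normal chi s v).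

Definition gauss_curvature chi s v : R :=
  (sfL chi s v * sfN chi s v - sfM chi s v ^+ 2) /
  (ffE chi s v * ffG chi s v - ffF chi s v ^+ 2).

Definition mean_curvature chi s v : R :=
  (ffE chi s v * sfN chi s v - 2 * sfM chi s v * ffF chi s v
     + sfL chi s v * ffG chi s v) /
  (2 * (ffE chi s v * ffG chi s v - ffF chi s v ^+ 2)).

Definition smarandache_TN1 (T N1 N2 : R -> 'rV[R]_3) : R -> R -> 'rV[R]_3 :=
  fun s v => (Num.sqrt 2)^-1 *: (T s + N1 s) + v *: N2 s.

End Surfaces.

(* Main.v *)
(** With a = 1 / sqrt 2, the Bishop equations give, in the frame (T, N1, N2),
    chi_s = (- (a k1 + v k2), a k1, a k2) and chi_v = (0, 0, 1), so the normal
    vector chi_s x chi_v = (a k1, a k1 + v k2, 0) has squared length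
    EG - F^2 = D.  Differentiating once more along the frame gives chi_ss,
    chi_sv = (- k2, 0, 0) and chi_vv = 0; both curvature formulas are then
    algebra, using 2 a^2 = 1. *)
Require Import Defs.
From HB Require Import structures.
From mathcomp Require Import all_boot all_order all_algebra.
From mathcomp Require Import all_classical all_reals all_analysis.
From mathcomp Require Import ring.
Import Order.TTheory GRing.Theory Num.Theory.
Import numFieldNormedType.Exports.
Local Open Scope ring_scope.
Local Open Scope classical_set_scope.

(** * Cross and dot products in coordinates and in an orthonormal frame *)

Section EuclideanSpace.
Context {R : realType}.
Implicit Types u v w : 'rV[R]_3.

Lemma ord3_ind (P : 'I_3 -> Prop) : P 0 -> P 1 -> P 2 -> forall i, P i.
Proof.
move=> P0 P1 P2 [[|[|[|//]]] lti].
- by rewrite (_ : Ordinal lti = 0)//; exact/val_inj.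
- by rewrite (_ : Ordinal lti = 1)//; exact/val_inj.
- by rewrite (_ : Ordinal lti = 2)//; exact/val_inj.
Qed.

Lemma sum_ord3 (F : 'I_3 -> R) : \sum_i F i = F 0 + F 1 + F 2.
Proof.
rewrite !big_ord_recl big_ord0 addr0 addrA.
by congr (_ + F _ + F _); exact/val_inj.
Qed.

Lemma dotE u v : dot u v = u 0 0 * v 0 0 + u 0 1 * v 0 1 + u 0 2 * v 0 2.
Proof. exact: sum_ord3. Qed.

Lemma cross0E u v : cross u v 0 0 = u 0 1 * v 0 2 - u 0 2 * v 0 1.
Proof. by rewrite mxE !add0r. Qed.

Lemma cross1E u v : cross u v 0 1 = u 0 2 * v 0 0 - u 0 0 * v 0 2.
Proof.
by rewrite mxE (_ : 1 + 1 = 2 :> 'I_3)// (_ : 1 + 2 = 0 :> 'I_3)//; exact/val_inj.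
Qed.

Lemma cross2E u v : cross u v 0 2 = u 0 0 * v 0 1 - u 0 1 * v 0 0.
Proof.
by rewrite mxE (_ : 2 + 1 = 0 :> 'I_3) 1?(_ : 2 + 2 = 1 :> 'I_3)//; exact/val_inj.
Qed.

Definition crossE := (cross0E, cross1E, cross2E).

Lemma dotvv_ge0 u : 0 <= dot u u.
Proof. by apply: sumr_ge0 => i _; rewrite -expr2 sqr_ge0. Qed.

Lemma dotvv_eq0 u : dot u u = 0 -> u = 0.
Proof.
move=> u0; apply/rowP => i; rewrite mxE; apply/eqP.
have ge0 j : true -> 0 <= u 0 j * u 0 j by rewrite -expr2 sqr_ge0.
by have /eqP := psumr_eq0P ge0 u0 (i := i) isT; rewrite mulf_eq0 orbb.
Qed.

Lemma dotC u v : dot u v = dot v u.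
Proof. by rewrite !dotE; ring. Qed.

Lemma dotZr (a : R) u v : dot u (a *: v) = a * dot u v.
Proof. by rewrite !dotE !mxE; ring. Qed.

(** Turns the determinant in [positively_oriented] into a triple product, the form in which
    orientation enters the cross product identities. *)
Lemma det_triple u v w :
  \det (col_mx u (col_mx v w) : 'M[R]_3) = dot u (cross v w).
Proof.
set A : 'M[R]_3 := (X in \det X).
have A0 j : A 0 j = u 0 j.
  by rewrite -[RHS](col_mxEu u (col_mx v w)); congr (A _ _); exact/val_inj.
have A1 j : A 1 j = v 0 j.
  rewrite -[RHS](col_mxEu v w) -(col_mxEd u (col_mx v w)).
  by congr (A _ _); exact/val_inj.
have A2 j : A 2 j = w 0 j.
  rewrite -[RHS](col_mxEd v w) -(col_mxEd u (col_mx v w)).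
  by congr (A _ _); exact/val_inj.
(* Listing the entries by numeric position lets the lifted indices produced by the cofactor
   expansions reduce by computation. *)
have AE i j : A i j = nth 0 (nth nil [:: [:: u 0 0; u 0 1; u 0 2];
    [:: v 0 0; v 0 1; v 0 2]; [:: w 0 0; w 0 1; w 0 2]] i) j.
  by elim/ord3_ind: i; rewrite ?A0 ?A1 ?A2; elim/ord3_ind: j.
clearbody A; rewrite (expand_det_row A 0) sum_ord3 /cofactor.
rewrite !(expand_det_row _ 0) !big_ord_recl !big_ord0 /cofactor !det_mx11 !mxE.
by rewrite !AE /= dotE !crossE; ring.
Qed.

(** Carries positivity of the triple product over to the cyclic permutations of a frame. *)
Lemma triple_cyclic u v w : dot u (cross v w) = dot v (cross w u).
Proof. by rewrite !dotE !crossE; ring. Qed.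

(* Lagrange's identity gives |v x w|^2 = 1 and the Gram determinant gives
   <u, v x w>^2 = 1, so that |v x w - u|^2 = 2 - 2 <u, v x w> = 0. *)
Lemma cross_orthonormal u v w :
  orthonormal3 u v w -> 0 < dot u (cross v w) -> cross v w = u.
Proof.
move=> [[uu vv ww] [uv uw vw]] d_gt0.
have gram : dot u (cross v w) ^+ 2 =
  dot u u * (dot v v * dot w w - dot v w ^+ 2)
  - dot u v * (dot u v * dot w w - dot v w * dot u w)
  + dot u w * (dot u v * dot v w - dot v v * dot u w).
  by rewrite !dotE !crossE; ring.
have d1 : dot u (cross v w) = 1.
  apply/eqP; rewrite -(@pexpr_eq1 _ _ 2) ?ltW//.
  by rewrite gram uu vv ww uv uw vw; apply/eqP; ring.
apply/eqP; rewrite -subr_eq0; apply/eqP/dotvv_eq0.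
have -> : dot (cross v w - u) (cross v w - u) =
  (dot v v * dot w w - dot v w ^+ 2) - 2 * dot u (cross v w) + dot u u.
  by rewrite !dotE !(crossE, mxE); ring.
by rewrite uu vv ww vw d1; ring.
Qed.

Definition comb3 u v w (a b c : R) : 'rV[R]_3 := a *: u + b *: v + c *: w.

(** A positively oriented orthonormal frame has the multiplication table of the standard basis, by
    [cross_orthonormal] applied to its three cyclic permutations; bilinearity does the rest. *)
Lemma cross_comb3 u v w a b c a' b' c' :
  orthonormal3 u v w -> positively_oriented u v w ->
  cross (comb3 u v w a b c) (comb3 u v w a' b' c') =
  comb3 u v w (b * c' - c * b') (c * a' - a * c') (a * b' - b * a').
Proof.
move=> ortho; rewrite /positively_oriented det_triple => d_gt0.
have [[uu vv ww] [uv uw vw]] := ortho.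
have vwE : cross v w = u by exact: cross_orthonormal.
have wuE : cross w u = v.
  apply: cross_orthonormal; last by rewrite -triple_cyclic.
  by split; split => //; rewrite dotC.
have uvE : cross u v = w.
  apply: cross_orthonormal; last by rewrite triple_cyclic.
  by split; split => //; rewrite dotC.
(* This bilinear expansion is valid for arbitrary vectors; the frame enters only afterwards. *)
transitivity (comb3 (cross v w) (cross w u) (cross u v)
  (b * c' - c * b') (c * a' - a * c') (a * b' - b * a')).
  by apply/rowP; elim/ord3_ind; rewrite /comb3 !(crossE, mxE); ring.
by rewrite vwE wuE uvE.
Qed.

Lemma dot_comb3 u v w a b c a' b' c' : orthonormal3 u v w ->
  dot (comb3 u v w a b c) (comb3 u v w a' b' c') = a * a' + b * b' + c * c'.
Proof.
move=> [[uu vv ww] [uv uw vw]].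
transitivity (a * a' * dot u u + b * b' * dot v v + c * c' * dot w w
  + (a * b' + b * a') * dot u v + (a * c' + c * a') * dot u w
  + (b * c' + c * b') * dot v w).
  by rewrite !dotE !mxE; ring.
by rewrite uu vv ww uv uw vw; ring.
Qed.

End EuclideanSpace.

(** * Differentiation along a Bishop frame *)

Section Derivatives.
Context {R : realType}.

(** Derivatives of row vectors are taken entrywise, so this reduces to the scalar product rule. *)
Lemma is_derive_scale {n : nat} {k : R -> R} {f : R -> 'rV[R]_n} {s dk : R} {df} :
  is_derive s 1 k dk -> is_derive s 1 f df ->
  is_derive s 1 (fun x => k x *: f x) (dk *: f s + k s *: df).
Proof.
move=> kd fd; have [fdb fE] := fd.
have comp i j : is_derive s 1 (fun x => (k x *: f x) i j) (dk * f s i j + k s * df i j).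
  rewrite (_ : (fun x => _) = k * (fun x => f x i j)); last first.
    by apply/funext => x; rewrite mxE.
  have fij : is_derive s 1 (fun x => f x i j) (df i j).
    split; first by move/derivable_mxP : fdb; exact.
    by rewrite -fE derive_mx// mxE.
  by apply: is_derive_eq; rewrite /GRing.scale /=; ring.
have db : derivable (fun x => k x *: f x) s 1.
  by apply/derivable_mxP => i j; have [] := comp i j.
split => //; rewrite derive_mx//; apply/matrixP => i j; rewrite !mxE.
by have [_ ->] := comp i j.
Qed.

Lemma derive1_affine (n : nat) (a b : 'rV[R]_n) (t : R) :
  derive1 (fun x => a + x *: b) t = b.
Proof.
have df : is_derive t 1 (fun x => a + x *: b) b.
  have := is_deriveD (is_derive_cst a t 1)
    (is_derive_scale (is_derive_id t 1) (is_derive_cst b t 1)).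
  by rewrite add0r scale1r scaler0 addr0.
by rewrite derive1E derive_val.
Qed.

Lemma smooth_is_derive {V : normedModType R} {I : set R} {f : R -> V} {s : R} :
  smooth_on I f -> I s -> is_derive s 1 f (derive1 f s).
Proof. by move=> fI Is; rewrite derive1E; exact/derivableP/(fI 0%N s Is). Qed.

(** Product rule plus the Bishop equations: [T'] feeds the two normal coordinates, while [N1'] and
    [N2'] feed only the tangential one. Every s-derivative of the surface is an instance. *)
Lemma bishop_is_derive_comb3 {I : set R} {gamma T N1 N2 : R -> 'rV[R]_3}
    {k1 k2 a b c : R -> R} {s a' b' c' : R} :
  bishop_frame I gamma T N1 N2 k1 k2 -> I s ->
  is_derive s 1 a a' -> is_derive s 1 b b' -> is_derive s 1 c c' ->
  is_derive s 1 (fun x => comb3 (T x) (N1 x) (N2 x) (a x) (b x) (c x))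
    (comb3 (T s) (N1 s) (N2 s) (a' - b s * k1 s - c s * k2 s)
       (b' + a s * k1 s) (c' + a s * k2 s)).
Proof.
move=> hf Is da db dc; have [[smT smN1 smN2] _ _ _ _ dT dN1 dN2] := hf.
have := smooth_is_derive smT Is; rewrite (dT _ Is) => T'.
have := smooth_is_derive smN1 Is; rewrite (dN1 _ Is) => N1'.
have := smooth_is_derive smN2 Is; rewrite (dN2 _ Is) => N2'.
have := is_deriveD (is_deriveD (is_derive_scale da T') (is_derive_scale db N1'))
  (is_derive_scale dc N2').
move/is_derive_eq; apply; apply/rowP => i; rewrite !mxE; ring.
Qed.

Lemma powR3half (x : R) : 0 < x -> x `^ (3 / 2) = x * Num.sqrt x.
Proof.
move=> x0; rewrite (_ : 3 / 2 = 1 + 2^-1); last by field.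
by rewrite powRD ?gt_eqF ?implybT// powRr1 ?powR12_sqrt// ltW.
Qed.

End Derivatives.

(** * Fundamental forms and curvatures of the ruled surface *)

Theorem theorem3p1 (R : realType) (I : set R)
  (gamma T N1 N2 : R -> 'rV[R]_3) (k1 k2 : R -> R)
  (openI : open I) (intervalI : is_interval I)
  (hgamma : unit_speed_curve I gamma)
  (hframe : bishop_frame I gamma T N1 N2 k1 k2) :
  let chi := smarandache_TN1 T N1 N2 in
  let D := fun s v : R =>
    k1 s ^+ 2 + v ^+ 2 * k2 s ^+ 2 + Num.sqrt 2 * v * k1 s * k2 s in
  forall s v : R, I s ->
    (D s v <> 0 <-> cross (pd_s chi s v) (pd_v chi s v) <> 0) /\
    (D s v <> 0 ->
       gauss_curvature chi s v = - (1 / 2) * (k1 s * k2 s / D s v) ^+ 2 /\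
       mean_curvature chi s v =
         (k1 s * k2 s ^+ 2 * (1 - 2 * v ^+ 2)
          + v * k2 s * (Num.sqrt 2 * derive1 k1 s - 2 * Num.sqrt 2 * k1 s ^+ 2)
          - Num.sqrt 2 * v * k1 s * derive1 k2 s
          - 2 * k1 s ^+ 3)
         / (4 * (D s v) `^ (3 / 2))).
Proof.
move=> chi D s v Is.
set r := Num.sqrt 2.
have r2 : r ^+ 2 = 2 by rewrite sqr_sqrtr.
have r0 : r != 0 by rewrite sqrtr_eq0 -ltNge ltr0n.
(* Both the surface and the target formulas are expressed through [a]; [a2] and [ra] then leave only
   polynomial identities. *)
pose a := r^-1.
have a2 : a ^+ 2 = 2^-1 by rewrite exprVn r2.
have ra : r = 2 * a by rewrite /a -r2 expr2 mulfK.
pose fr x := comb3 (T x) (N1 x) (N2 x).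
have pds x y : I x ->
    pd_s chi x y = fr x (- (a * k1 x + y * k2 x)) (a * k1 x) (a * k2 x).
  move=> Ix; rewrite /pd_s derive1E.
  (* For fixed [y] the surface traces a curve with constant frame coordinates [(a, a, y)]. *)
  rewrite (_ : (fun _ => _) = fun z => fr z (cst a z) (cst a z) (cst y z)).
    have := bishop_is_derive_comb3 hframe Ix (is_derive_cst a x 1)
      (is_derive_cst a x 1) (is_derive_cst y x 1).
    move=> H; rewrite derive_val /fr /=; congr comb3; ring.
  by apply/funext => z; rewrite /chi /smarandache_TN1 /fr /comb3 scalerDr.
have pdv x y : pd_v chi x y = fr x 0 0 1.
  by rewrite /pd_v derive1_affine /fr /comb3 !scale0r !add0r scale1r.
have pdss : pd_s (pd_s chi) s v =
    fr s (- (a * derive1 k1 s + v * derive1 k2 s) - a * k1 s ^+ 2 - a * k2 s ^+ 2)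
      (a * derive1 k1 s - (a * k1 s + v * k2 s) * k1 s)
      (a * derive1 k2 s - (a * k1 s + v * k2 s) * k2 s).
  rewrite {1}/pd_s derive1E.
  (* [pds] is known only on [I]; openness of [I] makes it hold near [s], which suffices for the
     derivative. *)
  rewrite (near_eq_derive (g := fun x =>
    fr x (- (a * k1 x + v * k2 x)) (a * k1 x) (a * k2 x))); last first.
    by near=> x; apply: pds; near: x; exact: open_nbhs_nbhs.
  have [smk1 smk2] := bishop_curv_smooth hframe.
  have dk1 := smooth_is_derive smk1 Is.
  have dk2 := smooth_is_derive smk2 Is.
  have dak1 : is_derive s 1 (fun x => a * k1 x) (a * derive1 k1 s).
    exact: is_deriveZ.
  have dak2 : is_derive s 1 (fun x => a * k2 x) (a * derive1 k2 s).
    exact: is_deriveZ.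
  have dp : is_derive s 1 (fun x => - (a * k1 x + v * k2 x))
      (- (a * derive1 k1 s + v * derive1 k2 s)).
    exact: is_deriveN (is_deriveD dak1 (is_deriveZ v dk2)).
  have H := bishop_is_derive_comb3 hframe Is dp dak1 dak2.
  by rewrite derive_val /fr /=; congr comb3; ring.
have pdsv : pd_v (pd_s chi) s v = fr s (- k2 s) 0 0.
  (* By [pds], the s-partial is affine in [y] with direction [- k2 s *: T s]. *)
  rewrite {1}/pd_v (_ : (fun _ => _) = fun y =>
    fr s (- (a * k1 s)) (a * k1 s) (a * k2 s) + y *: fr s (- k2 s) 0 0).
    by rewrite derive1_affine.
  apply/funext => y; rewrite pds//; apply/rowP => i; rewrite !mxE; ring.
have pdvv : pd_v (pd_v chi) s v = fr s 0 0 0.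
  rewrite {1}/pd_v (_ : (fun _ => _) = cst (fr s 0 0 1)); last first.
    by apply/funext => y; rewrite pdv.
  by rewrite derive1_cst /fr /comb3 !scale0r !addr0.
have ortho := bishop_orthonormal hframe Is.
have orient := bishop_oriented hframe Is.
have nE : cross (pd_s chi s v) (pd_v chi s v) =
    fr s (a * k1 s) (a * k1 s + v * k2 s) 0.
  by rewrite pds// pdv cross_comb3//; rewrite /fr; congr comb3; ring.
(* The squared length of the normal vector found in [nE]; it matches [D] because
   [2 * a ^+ 2 = 1]. *)
have DE : D s v = (a * k1 s) ^+ 2 + (a * k1 s + v * k2 s) ^+ 2.
  rewrite /D -/r ra.
  transitivity (2 * a ^+ 2 * k1 s ^+ 2 + v ^+ 2 * k2 s ^+ 2 + 2 * a * v * k1 s * k2 s).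
    by rewrite a2; field.
  by ring.
have nn : dot (cross (pd_s chi s v) (pd_v chi s v))
              (cross (pd_s chi s v) (pd_v chi s v)) = D s v.
  by rewrite nE dot_comb3// DE; ring.
split.
  rewrite -nn; split=> [nz c0|nz c0]; last exact/nz/dotvv_eq0.
  by apply: nz; rewrite c0 dotE !mxE; ring.
move=> /eqP D0.
have Dgt0 : 0 < D s v by rewrite lt_def D0 -nn dotvv_ge0.
(* [q] is the length of the normal vector; with [D s v = q ^+ 2] the power 3/2 becomes [q ^+ 3], so
   [field] applies. *)
pose q := Num.sqrt (D s v).
have q2 : q ^+ 2 = D s v by rewrite sqr_sqrtr// ltW.
have q0 : q != 0 by rewrite gt_eqF// sqrtr_gt0.
have surfn : surf_normal chi s v = q^-1 *: fr s (a * k1 s) (a * k1 s + v * k2 s) 0.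
  by rewrite /surf_normal /enorm nn nE.
have E : ffE chi s v = D s v + a ^+ 2 * k2 s ^+ 2.
  by rewrite /ffE pds// dot_comb3// DE; ring.
have F : ffF chi s v = a * k2 s by rewrite /ffF pds// pdv dot_comb3//; ring.
have G : ffG chi s v = 1 by rewrite /ffG pdv dot_comb3//; ring.
(* The two terms in [a ^+ 2 * k1 s * derive1 k1 s] cancel. *)
have L : sfL chi s v = q^-1 *
  (a * v * (k2 s * derive1 k1 s - k1 s * derive1 k2 s)
   - 2 * a ^+ 2 * k1 s ^+ 3 - a ^+ 2 * k1 s * k2 s ^+ 2
   - 2 * a * v * k1 s ^+ 2 * k2 s - v ^+ 2 * k1 s * k2 s ^+ 2).
  by rewrite /sfL pdss surfn dotZr dot_comb3//; congr (_ * _); ring.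
have M : sfM chi s v = - (q^-1 * a * k1 s * k2 s).
  by rewrite /sfM pdsv surfn dotZr dot_comb3//; ring.
have N : sfN chi s v = 0 by rewrite /sfN pdvv surfn dotZr dot_comb3//; ring.
rewrite /gauss_curvature /mean_curvature E F G L M N powR3half// -/q -/r ra.
have den : (D s v + a ^+ 2 * k2 s ^+ 2) * 1 - (a * k2 s) ^+ 2 = q ^+ 2.
  by rewrite q2; ring.
rewrite !den -q2; split.
  (* Since N = 0, only -M^2 remains; expanding it exposes [a ^+ 2] for [a2]. *)
  rewrite mulr0 sub0r sqrrN (_ : (_ * k2 s) ^+ 2 =
    q^-1 ^+ 2 * a ^+ 2 * k1 s ^+ 2 * k2 s ^+ 2); last by ring.
  by rewrite a2; field.
(* The term -2MF adds [2 * a ^+ 2 * k1 s * k2 s ^+ 2] over [q], which flips the sign of the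
   corresponding term of L. *)
rewrite [X in X / _ = _](_ : _ = q^-1 *
  (a * v * (k2 s * derive1 k1 s - k1 s * derive1 k2 s)
   - 2 * a ^+ 2 * k1 s ^+ 3 + a ^+ 2 * k1 s * k2 s ^+ 2
   - 2 * a * v * k1 s ^+ 2 * k2 s - v ^+ 2 * k1 s * k2 s ^+ 2)); last by ring.
by rewrite a2; field.
Unshelve. all: by end_near. Qed.
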